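(* For any $\tau>0$, there exist blow-up solutions of the planar system of delay differential equations \[ x'(t)=x(t)-y(t)-x(t-\tau)\left(x^2(t)+y^2(t)\right),\qquad y'(t)=x(t)+y(t)-y(t-\tau)\left(x^2(t)+y^2(t)\right). \]
   Context: Solutions are considered for continuous initial data $(x,y):[-\tau,0]\to\mathbb{R}^2$ and satisfy the system for $t>0$ as long as they exist. A blow-up solution is a solution that diverges in finite time: there is a finite $T>0$ such that the solution exists on $[0,T)$ and $\sqrt{x^2(t)+y^2(t)}\to\infty$ as $t\uparrow T$. *)

(* Defs.v *)
From Stdlib Require Import Reals.
From Coquelicot Require Import Coquelicot.
Open Scope R_scope.

(* Functions are total on R, but only the restriction of the initial data
   (phi, psi) to [-tau, 0] and that of the solution (x, y) to [-tau, T) matter.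
   [continuous_on D f] is continuity relative to D, hence one-sided at the
   endpoints of D. *)
Definition initial_data (tau : R) (phi psi : R -> R) : Prop :=
  continuous_on (fun t => -tau <= t <= 0) phi /\
  continuous_on (fun t => -tau <= t <= 0) psi.

(* The equations are imposed for t > 0 only: generic continuous initial data
   gives no two-sided derivative at 0. Continuity on [-tau, T) is what links the
   initial data to the solution at t = 0. *)
Record is_solution (tau T : R) (phi psi x y : R -> R) : Prop := {
  sol_init : forall t, -tau <= t <= 0 -> x t = phi t /\ y t = psi t;
  sol_cont_x : continuous_on (fun t => -tau <= t < T) x;
  sol_cont_y : continuous_on (fun t => -tau <= t < T) y;
  sol_eq_x : forall t, 0 < t < T ->
    is_derive x t (x t - y t - x (t - tau) * (x t ^ 2 + y t ^ 2));
  sol_eq_y : forall t, 0 < t < T ->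
    is_derive y t (x t + y t - y (t - tau) * (x t ^ 2 + y t ^ 2))
}.

Definition blows_up_at (T : R) (x y : R -> R) : Prop :=
  filterlim (fun t => sqrt (x t ^ 2 + y t ^ 2))
    (at_left T) (Rbar_locally p_infty).

Definition is_blowup_solution (tau : R) (phi psi x y : R -> R) : Prop :=
  exists T : R,
    0 < T /\ is_solution tau T phi psi x y /\ blows_up_at T x y.

(* Main.v *)
Require Import Defs.
From Stdlib Require Import Reals Lra.
From Coquelicot Require Import Coquelicot.
Open Scope R_scope.

(** Write the system as z' = (1 + i) z - z(t - tau) |z|^2 with z = x + i y.  On
    the first delay interval the factor z(t - tau) is initial data, hence at
    our disposal.  Choosing z(t - tau) = - e^{it} and z = r e^{it} turns the
    system into the scalar equation r' = r + r^2, whose solution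
    r(t) = 1 / (e^{T - t} - 1) blows up at T.

    Taking T = tau / 2, the choice z(t - tau) = - e^{it} for 0 <= t <= T only
    prescribes the initial data on [- tau, - T].  The interval [- T, 0] is left
    to join this arc continuously to the starting value z(0) = r(0), by means
    of a cutoff function.  The radial equation is
    [is_derive_blowup_radius], the solution is [blowup_component], and
    [is_derive_blowup_component] puts the two together. *)

(** * Continuity *)

Lemma continuous_Rmax_l (a x : R) : continuous (Rmax a) x.
Proof.
apply continuous_ext with (fun u => (a + u + Rabs (u - a)) / 2).
  intros u; unfold Rmax, Rabs.
  destruct (Rle_dec a u); destruct (Rcase_abs (u - a)); lra.
unfold Rdiv; apply (continuous_mult (K := R_AbsRing)).
  apply (continuous_plus (V := R_NormedModule)).
    apply (continuous_plus (V := R_NormedModule)).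
      apply continuous_const.
    apply continuous_id.
  apply (continuous_comp (fun u => u - a) Rabs).
    apply (continuous_minus (V := R_NormedModule)).
      apply continuous_id.
    apply continuous_const.
  apply continuous_Rabs.
apply continuous_const.
Qed.

Lemma continuous_on_pointwise (D : R -> Prop) (f : R -> R) :
  (forall t, D t -> continuous f t) -> continuous_on D f.
Proof.
intros Hf t Dt P HP.
apply filter_le_within; exact (Hf t Dt P HP).
Qed.

(** * The radial equation *)

Definition blowup_radius (T t : R) : R := / (exp (T - t) - 1).

Lemma exp_sub_1_pos (T t : R) : t < T -> 0 < exp (T - t) - 1.
Proof.
intros Ht; generalize (exp_increasing 0 (T - t)); rewrite exp_0; lra.
Qed.

Lemma is_derive_blowup_radius (T t : R) : t < T ->
  is_derive (blowup_radius T) t (blowup_radius T t + blowup_radius T t ^ 2).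
Proof.
intros Ht; generalize (exp_sub_1_pos T t Ht); intros He.
unfold blowup_radius; auto_derive.
  unfold Rminus in *; lra.
unfold Rminus in *; field; lra.
Qed.

Lemma blowup_radius_diverges (T : R) :
  filterlim (blowup_radius T) (at_left T) (Rbar_locally p_infty).
Proof.
unfold blowup_radius.
apply (filterlim_comp _ _ _ (fun t => exp (T - t) - 1) Rinv _ (at_right 0)).
  2: exact filterlim_Rinv_0_right.
intros P [d Hd].
assert (Hc : continuous (fun t => exp (T - t) - 1) T).
  apply (ex_derive_continuous (V := R_NormedModule)); auto_derive; exact I.
specialize (Hc (ball 0 d)).
assert (H0 : locally (exp (T - T) - 1) (ball 0 d)).
  replace (exp (T - T) - 1) with 0.
    exists d; intros y Hy; exact Hy.
  replace (T - T) with 0 by ring; rewrite exp_0; ring.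
specialize (Hc H0).
destruct Hc as [e Hc].
exists e; intros t Ht tT.
apply Hd.
  exact (Hc t Ht).
exact (exp_sub_1_pos T t tT).
Qed.

(** * The solution, together with its history *)

(** The piecewise linear function that descends from 1 at - T to 0 at 0. *)
Definition history_cutoff (T t : R) : R := Rmax 0 (1 - Rmax 0 (1 + t / T)).

Lemma history_cutoff_past (T t : R) :
  0 < T -> t <= - T -> history_cutoff T t = 1.
Proof.
intros HT Ht; unfold history_cutoff.
assert (t / T <= - 1) by (apply Rle_div_l; lra).
rewrite (Rmax_left 0 (1 + t / T)) by lra.
rewrite Rmax_right; lra.
Qed.

Lemma history_cutoff_future (T t : R) :
  0 < T -> 0 <= t -> history_cutoff T t = 0.
Proof.
intros HT Ht; unfold history_cutoff.
assert (0 <= t / T) by (apply Rle_div_r; lra).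
rewrite (Rmax_right 0 (1 + t / T)) by lra.
rewrite Rmax_left; lra.
Qed.

Lemma continuous_history_cutoff (T t : R) : continuous (history_cutoff T) t.
Proof.
unfold history_cutoff.
apply (continuous_comp (fun t => 1 - Rmax 0 (1 + t / T)) (Rmax 0)).
  2: apply continuous_Rmax_l.
apply (continuous_minus (V := R_NormedModule)).
  apply continuous_const.
apply (continuous_comp (fun t => 1 + t / T) (Rmax 0)).
  2: apply continuous_Rmax_l.
apply (continuous_plus (V := R_NormedModule)).
  apply continuous_const.
unfold Rdiv; apply (continuous_mult (K := R_AbsRing)).
  apply continuous_id.
apply continuous_const.
Qed.

(** With f = cos and f = sin these are the two coordinates of z: the blow-up
    profile r(t) e^{it} for t >= 0 and the history - e^{i(t + tau)} for
    t <= - T, where tau = 2 T.  A convex combination, rather than a definition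
    by cases, makes continuity at - T and 0 automatic. *)
Definition blowup_component (T : R) (f : R -> R) (t : R) : R :=
  (1 - history_cutoff T t) * (blowup_radius T t * f t)
  - history_cutoff T t * f (t + 2 * T).

Lemma blowup_component_past (T : R) (f : R -> R) (t : R) :
  0 < T -> t <= - T -> blowup_component T f t = - f (t + 2 * T).
Proof.
intros HT Ht; unfold blowup_component; rewrite history_cutoff_past by easy.
ring.
Qed.

Lemma blowup_component_future (T : R) (f : R -> R) (t : R) :
  0 < T -> 0 <= t -> blowup_component T f t = blowup_radius T t * f t.
Proof.
intros HT Ht; unfold blowup_component; rewrite history_cutoff_future by easy.
ring.
Qed.

Lemma continuous_blowup_component (T : R) (f : R -> R) (t : R) :
  (forall u, continuous f u) -> t < T ->
  continuous (blowup_component T f) t.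
Proof.
intros Hf Ht; unfold blowup_component.
apply (continuous_minus (V := R_NormedModule)).
  apply (continuous_mult (K := R_AbsRing)).
    apply (continuous_minus (V := R_NormedModule)).
      apply continuous_const.
    apply continuous_history_cutoff.
  apply (continuous_mult (K := R_AbsRing)).
    apply (ex_derive_continuous (V := R_NormedModule)).
    eexists; apply is_derive_blowup_radius, Ht.
  apply Hf.
apply (continuous_mult (K := R_AbsRing)).
  apply continuous_history_cutoff.
apply (continuous_comp (fun t => t + 2 * T) f).
  apply (continuous_plus (V := R_NormedModule)).
    apply continuous_id.
  apply continuous_const.
apply Hf.
Qed.

(** The term r^2 f of the radial equation is the delayed term of the system,
    because the delayed component is - f. *)
Lemma is_derive_blowup_component (T : R) (f : R -> R) (t l : R) :
  0 < t < T -> is_derive f t l ->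
  is_derive (blowup_component T f) t
    (blowup_radius T t * f t + blowup_radius T t * l
     - blowup_component T f (t - 2 * T) * blowup_radius T t ^ 2).
Proof.
intros Ht Hf.
apply is_derive_ext_loc with (fun u => blowup_radius T u * f u).
  apply (filter_imp (fun u => 0 < u)).
    intros u Hu; rewrite blowup_component_future; lra.
  apply (open_gt 0); lra.
rewrite blowup_component_past by lra.
replace (t - 2 * T + 2 * T) with t by ring.
replace (_ - _) with
  ((blowup_radius T t + blowup_radius T t ^ 2) * f t + blowup_radius T t * l)
  by ring.
apply (is_derive_mult (K := R_AbsRing)).
    apply is_derive_blowup_radius; lra.
  exact Hf.
intros; apply Rmult_comm.
Qed.

Lemma blowup_component_norm2 (T t : R) : 0 < T -> 0 <= t ->
  blowup_component T cos t ^ 2 + blowup_component T sin t ^ 2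
  = blowup_radius T t ^ 2.
Proof.
intros HT Ht; rewrite !blowup_component_future by easy.
generalize (sin2_cos2 t); unfold Rsqr; intros H.
transitivity (blowup_radius T t ^ 2 * (sin t * sin t + cos t * cos t)).
  ring.
rewrite H; ring.
Qed.

Lemma blowup_components_solve (T : R) : 0 < T ->
  is_solution (2 * T) T (blowup_component T cos) (blowup_component T sin)
    (blowup_component T cos) (blowup_component T sin).
Proof.
intros HT; split.
- easy.
- apply continuous_on_pointwise; intros t Ht.
  apply continuous_blowup_component; [exact continuous_cos | lra].
- apply continuous_on_pointwise; intros t Ht.
  apply continuous_blowup_component; [exact continuous_sin | lra].
- intros t Ht; rewrite blowup_component_norm2 by lra.
  rewrite (blowup_component_future T cos t), (blowup_component_future T sin t)
    by lra.
  replace (blowup_radius T t * cos t - blowup_radius T t * sin t)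
    with (blowup_radius T t * cos t + blowup_radius T t * - sin t) by ring.
  apply is_derive_blowup_component; [easy | apply is_derive_cos].
- intros t Ht; rewrite blowup_component_norm2 by lra.
  rewrite (blowup_component_future T cos t), (blowup_component_future T sin t)
    by lra.
  rewrite (Rplus_comm (blowup_radius T t * cos t)).
  apply is_derive_blowup_component; [easy | apply is_derive_sin].
Qed.

Lemma blowup_components_blow_up (T : R) : 0 < T ->
  blows_up_at T (blowup_component T cos) (blowup_component T sin).
Proof.
intros HT; unfold blows_up_at.
apply filterlim_ext_loc with (blowup_radius T).
  2: apply blowup_radius_diverges.
exists (mkposreal T HT); intros t Ht tT.
change (Rabs (t - T) < T) in Ht; apply Rabs_def2 in Ht.
rewrite blowup_component_norm2 by lra.
rewrite sqrt_pow2; [easy | apply Rlt_le].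
apply Rinv_0_lt_compat, exp_sub_1_pos, tT.
Qed.

Theorem theorem1 :
  forall tau : R, 0 < tau ->
    exists phi psi : R -> R,
      initial_data tau phi psi /\
      exists x y : R -> R, is_blowup_solution tau phi psi x y.
Proof.
intros tau Htau.
set (T := tau / 2).
assert (HT : 0 < T) by (unfold T; lra).
replace tau with (2 * T) by (unfold T; field).
exists (blowup_component T cos), (blowup_component T sin); split.
  split; apply continuous_on_pointwise; intros t Ht;
    apply continuous_blowup_component;
    solve [lra | exact continuous_cos | exact continuous_sin].
exists (blowup_component T cos), (blowup_component T sin), T.
split; [easy | split].
  apply blowup_components_solve, HT.
apply blowup_components_blow_up, HT.
Qed.
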